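(* Let $n\geq 3$, and let $k\geq 3$ be odd. Two elements of $B_n/[P_n,P_n]$ of order $k$ are conjugate in $B_n/[P_n,P_n]$ if and only if their permutations have the same cycle type. Thus two finite cyclic subgroups of $B_n/[P_n,P_n]$ of order $k$ are conjugate if and only if their images under $\overline{\sigma}$ are conjugate in $S_n$.
   Context: $B_n$ is the Artin braid group with generators $\sigma_1,\ldots,\sigma_{n-1}$ and relations $\sigma_i\sigma_j=\sigma_j\sigma_i$ for $|i-j|\geq 2$, and $\sigma_{i+1}\sigma_i\sigma_{i+1}=\sigma_i\sigma_{i+1}\sigma_i$ for $1\leq i\leq n-2$. $S_n$ is the symmetric group, with permutations composed from left to right. $\sigma\colon B_n\to S_n$ is the homomorphism with $\sigma(\sigma_i)=(i,i+1)$, $P_n=\ker\sigma$ is the pure braid group, $[P_n,P_n]$ is its commutator subgroup, and $\overline{\sigma}\colon B_n/[P_n,P_n]\to S_n$ is the homomorphism induced by $\sigma$. The permutation of an element of $B_n/[P_n,P_n]$ is its image under $\overline{\sigma}$. *)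

(* Defs.v *)
From HB Require Import structures.
From mathcomp Require Import all_boot fingroup perm.
From mathcomp Require Import zify.
From mathcomp Require Import boolp classical_sets functions cardinality.

Set Implicit Arguments.
Unset Strict Implicit.
Unset Printing Implicit Defensive.

Local Open Scope group_scope.
Local Open Scope quotient_scope.
Local Open Scope classical_set_scope.

(* [fingroup] shadows this name. *)
Local Notation repr := generic_quotient.repr.

Section Groups.
Variable G : groupType.
Implicit Types (x y : G) (A H K : set G).

Definition is_subgroup H := H 1 /\ forall x y, H x -> H y -> H (x / y).

Definition subgroup_gen A : set G := smallest is_subgroup A.

Definition commutator_subgroup H : set G :=
  subgroup_gen [set z | exists x y, [/\ H x, H y & z = [~ x, y]]].

Definition has_order (k : nat) x :=
  [/\ (0 < k)%N, x ^+ k = 1 & forall j, (0 < j < k)%N -> x ^+ j <> 1].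

Definition are_conj x y := exists g, y = x ^ g.

Definition are_conj_sets H K := exists g, K = (fun x => x ^ g) @` H.

Definition is_cyclic_subgroup H := exists x, H = subgroup_gen [set x].

Definition cyclic_subgroup_of_order (k : nat) H :=
  is_cyclic_subgroup H /\ (H #= `I_k)%card.

Lemma subgroup_gen_subgroup A : is_subgroup (subgroup_gen A).
Proof.
split=> [H [[H1 _] _] //|x y Ax Ay H [sH sAH]].
by apply: (proj2 sH); [apply: Ax | apply: Ay].
Qed.

Lemma sub_subgroup_gen A : A `<=` subgroup_gen A.
Proof. by move=> x Ax H [_]; apply. Qed.

Lemma subgroup_gen_min A H : is_subgroup H -> A `<=` H -> subgroup_gen A `<=` H.
Proof. by move=> sH sAH x; apply. Qed.

End Groups.

Record normalSubgroup (G : groupType) := NormalSubgroup {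
  nset :> set G;
  nset_subgroup : is_subgroup nset;
  nset_conj : forall x g, nset x -> nset (x ^ g) }.

Section CommutatorNormal.
Variables (G : groupType) (N : normalSubgroup G).

Lemma commutator_subgroup_conj x g :
  commutator_subgroup N x -> commutator_subgroup N (x ^ g).
Proof.
apply: (@subgroup_gen_min _ _ [set z : G | commutator_subgroup N (z ^ g)]).
  have [D1 DV] := @subgroup_gen_subgroup G
    [set z | exists x y, [/\ nset N x, nset N y & z = [~ x, y]]].
  split=> [|y z Dy Dz] /=; first by rewrite conj1g.
  by rewrite conjMg conjVg; apply: DV.
move=> _ [y [z [Ny Nz ->]]] /=; rewrite conjRg; apply: sub_subgroup_gen.
by exists (y ^ g), (z ^ g); split=> //; apply: nset_conj.
Qed.

Definition commutator_normal : normalSubgroup G :=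
  NormalSubgroup (subgroup_gen_subgroup _) commutator_subgroup_conj.

End CommutatorNormal.

Section QuotientGroup.
Variables (G : groupType) (N : normalSubgroup G).

Definition coset_eq (x y : G) : bool := `[< nset N (x^-1 * y) >].

Lemma nset1 : nset N 1. Proof. exact: (proj1 (nset_subgroup N)). Qed.

Lemma nsetV x : nset N x -> nset N x^-1.
Proof.
move=> Nx; rewrite -[x^-1]mul1g.
by apply: (proj2 (nset_subgroup N)) => //; apply: nset1.
Qed.

Lemma nsetM x y : nset N x -> nset N y -> nset N (x * y).
Proof.
move=> Nx /nsetV Ny; rewrite -[y]invgK.
exact: (proj2 (nset_subgroup N)).
Qed.

Lemma coset_eq_refl : reflexive coset_eq.
Proof. by move=> x; apply/asboolP; rewrite mulVg; apply: nset1. Qed.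

Lemma coset_eq_sym : symmetric coset_eq.
Proof.
by move=> x y; apply/asboolP/asboolP => /nsetV; rewrite invgM invgK.
Qed.

Lemma coset_eq_trans : transitive coset_eq.
Proof.
move=> y x z /asboolP Nxy /asboolP Nyz; apply/asboolP.
by have := nsetM Nxy Nyz; rewrite mulgA mulgK.
Qed.

Definition coset_equiv := EquivRel coset_eq
  coset_eq_refl coset_eq_sym coset_eq_trans.

Definition quotient_group := {eq_quot coset_equiv}.
HB.instance Definition _ := Choice.on quotient_group.
HB.instance Definition _ := EqQuotient.on quotient_group.

Definition quot_pi (x : G) : quotient_group := \pi x.

Lemma quot_piP x y : quot_pi x = quot_pi y <-> nset N (x^-1 * y).
Proof.
split=> [/eqmodP /asboolP //|Nxy].
by apply/eqmodP/asboolP.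
Qed.

Lemma quot_pi_repr (q : quotient_group) : quot_pi (repr q) = q.
Proof. exact: reprK. Qed.

Definition quot_mul (p q : quotient_group) := quot_pi (repr p * repr q).
Definition quot_inv (p : quotient_group) := quot_pi (repr p)^-1.

Lemma quot_pi_mul x y : quot_mul (quot_pi x) (quot_pi y) = quot_pi (x * y).
Proof.
apply/esym/quot_piP.
have /quot_piP Nx : quot_pi x = quot_pi (repr (quot_pi x))
  by rewrite quot_pi_repr.
have /quot_piP Ny : quot_pi y = quot_pi (repr (quot_pi y))
  by rewrite quot_pi_repr.
have := nsetM (nset_conj y Nx) Ny.
by rewrite conjgE invgM !mulgA mulgK.
Qed.

Lemma quot_pi_inv x : quot_inv (quot_pi x) = quot_pi x^-1.
Proof.
apply/quot_piP; rewrite invgK.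
have /quot_piP Nx : quot_pi (repr (quot_pi x)) = quot_pi x
  by rewrite quot_pi_repr.
have := nset_conj (repr (quot_pi x))^-1 Nx.
by rewrite conjgE invgK mulgA mulgA mulgV mul1g => /nsetV; rewrite invgM invgK.
Qed.

Lemma quot_mulA : associative quot_mul.
Proof.
move=> p q r; rewrite -(quot_pi_repr p) -(quot_pi_repr q) -(quot_pi_repr r).
by rewrite !quot_pi_mul mulgA.
Qed.

Lemma quot_mul1g : left_id (quot_pi 1) quot_mul.
Proof. by move=> p; rewrite -(quot_pi_repr p) quot_pi_mul mul1g. Qed.

Lemma quot_mulg1 : right_id (quot_pi 1) quot_mul.
Proof. by move=> p; rewrite -(quot_pi_repr p) quot_pi_mul mulg1. Qed.

Lemma quot_mulVg : left_inverse (quot_pi 1) quot_inv quot_mul.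
Proof.
by move=> p; rewrite -(quot_pi_repr p) quot_pi_inv quot_pi_mul mulVg.
Qed.

Lemma quot_mulgV : right_inverse (quot_pi 1) quot_inv quot_mul.
Proof.
by move=> p; rewrite -(quot_pi_repr p) quot_pi_inv quot_pi_mul mulgV.
Qed.

HB.instance Definition _ := isGroup.Build quotient_group
  quot_mulA quot_mul1g quot_mulg1 quot_mulVg quot_mulgV.

Lemma quot_piM : {morph quot_pi : x y / x * y}.
Proof. by move=> x y; rewrite -quot_pi_mul. Qed.

End QuotientGroup.

Section PresentedGroup.
Variables (X : choiceType).

(* The letter [(x, true)] stands for the generator [x] and [(x, false)] for
   its formal inverse. *)
Definition word := seq (X * bool).

Variable rels : word -> word -> Prop.

Inductive word_eq : word -> word -> Prop :=
| word_eq_refl u : word_eq u u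
| word_eq_sym u v : word_eq u v -> word_eq v u
| word_eq_trans u v w : word_eq u v -> word_eq v w -> word_eq u w
| word_eq_cat u u' v v' :
    word_eq u u' -> word_eq v v' -> word_eq (u ++ v) (u' ++ v')
| word_eq_cancel x b : word_eq [:: (x, b); (x, ~~ b)] [::]
| word_eq_rel u v : rels u v -> word_eq u v.

Definition word_eqb (u v : word) : bool := `[< word_eq u v >].

Lemma word_eqb_refl : reflexive word_eqb.
Proof. by move=> u; apply/asboolP/word_eq_refl. Qed.

Lemma word_eqb_sym : symmetric word_eqb.
Proof. by move=> u v; apply/asboolP/asboolP => /word_eq_sym. Qed.

Lemma word_eqb_trans : transitive word_eqb.
Proof.
by move=> v u w /asboolP uv /asboolP vw; apply/asboolP/(word_eq_trans uv).
Qed.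

Definition word_equiv := EquivRel word_eqb
  word_eqb_refl word_eqb_sym word_eqb_trans.

Definition presented := {eq_quot word_equiv}.
HB.instance Definition _ := Choice.on presented.
HB.instance Definition _ := EqQuotient.on presented.

Definition of_word (u : word) : presented := \pi u.

Lemma of_wordP u v : of_word u = of_word v <-> word_eq u v.
Proof.
split=> [/eqmodP /asboolP //|uv].
by apply/eqmodP/asboolP.
Qed.

Lemma of_word_repr (p : presented) : of_word (repr p) = p.
Proof. exact: reprK. Qed.

Definition word_inv (u : word) : word := rev [seq (l.1, ~~ l.2) | l <- u].

Lemma word_inv_cat u v : word_inv (u ++ v) = word_inv v ++ word_inv u.
Proof. by rewrite /word_inv map_cat rev_cat. Qed.

Lemma word_invK : involutive word_inv.
Proof.
move=> u; rewrite /word_inv map_rev revK -map_comp -[RHS]map_id.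
by apply: eq_map => -[x b] /=; rewrite negbK.
Qed.

Lemma word_mulgV u : word_eq (u ++ word_inv u) [::].
Proof.
elim/last_ind: u => [|u [x b] IHu]; first exact: word_eq_refl.
rewrite -cats1 word_inv_cat -catA.
apply: word_eq_trans IHu; apply: word_eq_cat; first exact: word_eq_refl.
rewrite catA -[X in word_eq _ X]cat0s; apply: word_eq_cat; last first.
  exact: word_eq_refl.
exact: word_eq_cancel.
Qed.

Lemma word_mulVg u : word_eq (word_inv u ++ u) [::].
Proof. by rewrite -{2}[u]word_invK; apply: word_mulgV. Qed.

Lemma word_eq_inv u v : word_eq u v -> word_eq (word_inv u) (word_inv v).
Proof.
move=> uv; apply: (@word_eq_trans _ (word_inv u ++ (v ++ word_inv v))).
  rewrite -[X in word_eq X _]cats0; apply: word_eq_cat.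
    exact: word_eq_refl.
  exact/word_eq_sym/word_mulgV.
rewrite catA -[X in word_eq _ X]cat0s; apply: word_eq_cat; last first.
  exact: word_eq_refl.
apply: word_eq_trans (word_mulVg u).
by apply: word_eq_cat; [exact: word_eq_refl | exact: word_eq_sym].
Qed.

Definition pres_mul (p q : presented) := of_word (repr p ++ repr q).
Definition pres_inv (p : presented) := of_word (word_inv (repr p)).

Lemma of_word_mul u v : pres_mul (of_word u) (of_word v) = of_word (u ++ v).
Proof. by apply/of_wordP/word_eq_cat; apply/of_wordP; rewrite of_word_repr. Qed.

Lemma of_word_inv u : pres_inv (of_word u) = of_word (word_inv u).
Proof. by apply/of_wordP/word_eq_inv; apply/of_wordP; rewrite of_word_repr. Qed.

Lemma pres_mulA : associative pres_mul.
Proof.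
move=> p q r; rewrite -(of_word_repr p) -(of_word_repr q) -(of_word_repr r).
by rewrite !of_word_mul catA.
Qed.

Lemma pres_mul1g : left_id (of_word [::]) pres_mul.
Proof. by move=> p; rewrite -(of_word_repr p) of_word_mul cat0s. Qed.

Lemma pres_mulg1 : right_id (of_word [::]) pres_mul.
Proof. by move=> p; rewrite -(of_word_repr p) of_word_mul cats0. Qed.

Lemma pres_mulVg : left_inverse (of_word [::]) pres_inv pres_mul.
Proof.
move=> p; rewrite -(of_word_repr p) of_word_inv of_word_mul.
exact/of_wordP/word_mulVg.
Qed.

Lemma pres_mulgV : right_inverse (of_word [::]) pres_inv pres_mul.
Proof.
move=> p; rewrite -(of_word_repr p) of_word_inv of_word_mul.
exact/of_wordP/word_mulgV.
Qed.

HB.instance Definition _ := isGroup.Build presented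
  pres_mulA pres_mul1g pres_mulg1 pres_mulVg pres_mulgV.

Lemma of_wordM u v : of_word (u ++ v) = of_word u * of_word v.
Proof. by rewrite -of_word_mul. Qed.

Definition pres_gen (x : X) : presented := of_word [:: (x, true)].

Section Lift.
Variables (G : groupType) (f : X -> G).

Definition word_eval (u : word) : G :=
  \prod_(l <- u) (if l.2 then f l.1 else (f l.1)^-1).

Definition respects_rels := forall u v, rels u v -> word_eval u = word_eval v.

Hypothesis fP : respects_rels.

Lemma word_eval_eq u v : word_eq u v -> word_eval u = word_eval v.
Proof.
elim=> {u v} //.
- by move=> u v w _ -> _ ->.
- by move=> u u' v v' _ eu _ ev; rewrite /word_eval !big_cat /=; congr (_ * _).
- move=> x [] /=; rewrite /word_eval !big_cons big_nil /= mulg1.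
    exact: mulgV.
  exact: mulVg.
Qed.

Definition pres_lift (p : presented) : G := word_eval (repr p).

Lemma pres_lift_of_word u : pres_lift (of_word u) = word_eval u.
Proof. by apply/word_eval_eq/of_wordP; rewrite of_word_repr. Qed.

Lemma pres_lift_gen x : pres_lift (pres_gen x) = f x.
Proof. by rewrite pres_lift_of_word /word_eval big_seq1. Qed.

Lemma pres_liftM : {morph pres_lift : p q / p * q}.
Proof.
move=> p q; rewrite -(of_word_repr p) -(of_word_repr q) -of_wordM.
by rewrite !pres_lift_of_word /word_eval big_cat.
Qed.

End Lift.
End PresentedGroup.

Section Braid.
Variable n : nat.

(* Indices are shifted down by one: [i : 'I_n.-1] with value [a] stands for
   the generator sigma_(a+1) and for the transposition (a+1, a+2). *)
Inductive braid_rels : word 'I_n.-1 -> word 'I_n.-1 -> Prop :=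
| braid_comm (i j : 'I_n.-1) : (i.+2 <= j)%N || (j.+2 <= i)%N ->
    braid_rels [:: (i, true); (j, true)] [:: (j, true); (i, true)]
| braid_braid (i j : 'I_n.-1) : j = i.+1 :> nat ->
    braid_rels [:: (j, true); (i, true); (j, true)]
               [:: (i, true); (j, true); (i, true)].

Definition braid := presented braid_rels.
HB.instance Definition _ := Group.on braid.

Definition braid_gen (i : 'I_n.-1) : braid := pres_gen braid_rels i.

Lemma succ_lt_pred (i : 'I_n.-1) : (i.+1 < n)%N.
Proof. by rewrite -ltn_predRL. Qed.

Definition adj_tperm (i : 'I_n.-1) : 'S_n :=
  tperm (widen_ord (leq_pred n) i) (Ordinal (succ_lt_pred i)).

Lemma adj_tperm_rels : respects_rels braid_rels adj_tperm.
Proof.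
have tpermsK (a b : 'I_n) (s : 'S_n) :
    tperm a b * (s * tperm a b) = s ^ tperm a b.
  by rewrite conjgE tpermV mulgA.
move=> _ _ [i j ij|i j ij];
  rewrite /word_eval !big_cons !big_nil /= !mulg1.
  rewrite [RHS]conjgC; congr (_ * _); apply/esym.
  by rewrite tpermJ !tpermD // -val_eqE /=; apply/eqP; lia.
rewrite /adj_tperm !tpermsK !tpermJ.
have <- : widen_ord (leq_pred n) j = Ordinal (succ_lt_pred i) by exact: val_inj.
by rewrite tpermR tpermL !tpermD // -val_eqE /=; apply/eqP; lia.
Qed.

(* Permutations multiply from left to right: [(s * t) x = t (s x)]. *)
Definition sigma : braid -> 'S_n := pres_lift adj_tperm.

Lemma sigma_gen i : sigma (braid_gen i) = adj_tperm i.
Proof. exact: pres_lift_gen adj_tperm_rels i. Qed.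

Lemma sigmaM : {morph sigma : x y / x * y}.
Proof. exact: pres_liftM adj_tperm_rels. Qed.

Lemma sigma1 : sigma 1 = 1.
Proof. by apply: (mulgI (sigma 1)); rewrite -sigmaM !mulg1. Qed.

HB.instance Definition _ := isMultiplicative.Build braid 'S_n sigma sigmaM.
HB.instance Definition _ :=
  Multiplicative_isUMagmaMorphism.Build braid 'S_n sigma sigma1.

Definition pure_braid_set : set braid := [set b | sigma b = 1].

Lemma pure_braid_subgroup : is_subgroup pure_braid_set.
Proof.
split=> [|x y Px Py]; first exact: sigma1.
by rewrite /pure_braid_set /= gmulfF /= Px Py divg1.
Qed.

Lemma pure_braid_conj x g : pure_braid_set x -> pure_braid_set (x ^ g).
Proof. by move=> Px; rewrite /pure_braid_set /= gmulfJ /= Px conj1g. Qed.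

Definition pure_braid : normalSubgroup braid :=
  NormalSubgroup pure_braid_subgroup pure_braid_conj.

(* The crystallographic braid group B_n / [P_n, P_n]. *)
Definition crystal_braid := quotient_group (commutator_normal pure_braid).
HB.instance Definition _ := Group.on crystal_braid.

(* By [sigma_bar_pi] below, this does not depend on the representative. *)
Definition sigma_bar (q : crystal_braid) : 'S_n := sigma (repr q).

Lemma sigma_commutator_subgroup b :
  commutator_subgroup pure_braid b -> sigma b = 1.
Proof.
apply: (subgroup_gen_min pure_braid_subgroup) => _ [x [y [Px Py ->]]].
by rewrite /pure_braid_set /= gmulfR /= Px Py commg1.
Qed.

Lemma sigma_bar_pi b :
  sigma_bar (quot_pi (commutator_normal pure_braid) b) = sigma b.
Proof.
have /quot_piP/sigma_commutator_subgroup :=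
  quot_pi_repr (quot_pi (commutator_normal pure_braid) b).
by rewrite gmulfM gmulfV => /(canRL (mulKVg _)); rewrite mulg1.
Qed.

Lemma sigma_barM : {morph sigma_bar : x y / x * y}.
Proof.
move=> x y; rewrite -[x in LHS]quot_pi_repr -[y in LHS]quot_pi_repr -quot_piM.
by rewrite sigma_bar_pi sigmaM.
Qed.

Lemma sigma_bar1 : sigma_bar 1 = 1.
Proof. by apply: (mulgI (sigma_bar 1)); rewrite -sigma_barM !mulg1. Qed.

HB.instance Definition _ :=
  isMultiplicative.Build crystal_braid 'S_n sigma_bar sigma_barM.
HB.instance Definition _ :=
  Multiplicative_isUMagmaMorphism.Build crystal_braid 'S_n sigma_bar sigma_bar1.

End Braid.

(* The partition of [#|T|] given by the cycle lengths of [s], fixed points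
   included, in nonincreasing order. *)
Definition cycle_type (T : finType) (s : {perm T}) : seq nat :=
  sort geq [seq #|pred_of_set c| | c in porbits s].

(* Main.v *)
Require Import Defs.
From HB Require Import structures.
From mathcomp Require Import all_boot all_order all_algebra fingroup perm.
From mathcomp Require Import zify finmap.
From mathcomp Require Import boolp classical_sets cardinality.

(* The kernel M = P_n/[P_n,P_n] of sigma_bar is free abelian on the classes of
   the A_ij, which are permuted by B_n/[P_n,P_n] through S_n. Two elements x, y
   of finite order with the same permutation s differ by m = y x^-1 in M, and
   x^k = y^k = 1 says that m has trivial norm under <s>. Since M is a
   permutation module, H^1(<s>, M) = 0, so m is a coboundary and y is a
   conjugate of x by an element of M. Permutations with the same cycle type are
   conjugate in S_n, and lifting the conjugating permutation to B_n reduces to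
   this case.

   Linear independence of the A_ij is detected by the homomorphism from B_n to
   Z^(S_n) >< S_n sending sigma_i to (e_s, s), where s = (i, i+1): it kills
   [P_n,P_n] and maps A_ij to 2 e_(i,j). That the A_ij generate M and only
   depend on {i, j} modulo [P_n,P_n] follows from the normal form for S_n along
   the chain S_1 < S_2 < ... < S_n: modulo squares of generators, an element of
   B_n whose permutation is trivial is trivial, and one whose permutation
   preserves {1, 2} is a product of sigma_1, sigma_3, ..., sigma_(n-1). *)

Set Implicit Arguments.
Unset Strict Implicit.
Unset Printing Implicit Defensive.

Local Notation repr := generic_quotient.repr.

(** * First cohomology of a cyclic group in a permutation module *)

(** The value of [b] at a point is the sum of [v] along its cycle, from a chosen base point up to
    just before that point. Extra turns around the cycle do not change it: a multiple of the cycle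
    sum vanishes, and the integers have no torsion. *)
Lemma orbit_sum_coboundary (X : finType) (p : {perm X}) (k : nat)
    (v : X -> int) :
    (0 < k)%N -> (p ^+ k = 1)%g ->
    (forall x, \sum_(i < k) v ((p ^+ i)%g x) = 0)%R ->
  exists b : X -> int, forall x, (v x = b (p x) - b x)%R.
Proof.
move=> k_gt0 pk1 vk0; pose F x j := (\sum_(i < j) v ((p ^+ i)%g x))%R.
have FD x i j : (F x (i + j) = F x i + F ((p ^+ i)%g x) j)%R.
  rewrite /F big_split_ord /=; congr (_ + _)%R; apply: eq_bigr => l _.
  by rewrite expgnDr permM.
have F_fix x d : (p ^+ d)%g x = x -> F x d = 0%R.
  move=> pdx.
  (* A walk of [d * k] steps from [x] is read both as [k] closed walks of length [d] and as [d]
     walks of length [k]. *)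
  have FM m : F x (d * m) = (F x d *+ m)%R.
    elim: m => [|m IHm]; first by rewrite muln0 GRing.mulr0n /F big_ord0.
    by rewrite mulnS FD pdx IHm GRing.mulrS.
  have FkM m y : F y (k * m) = 0%R.
    elim: m y => [|m IHm] y; first by rewrite muln0 /F big_ord0.
    by rewrite mulnS FD pk1 perm1 IHm GRing.addr0; apply: vk0.
  have := FM k; rewrite mulnC FkM => /esym/eqP.
  by rewrite Num.Theory.mulrn_eq0; lia.
(* The choice depends on the nonempty set [porbit p x] only, so [r] is constant on cycles. *)
pose r x := odflt x [pick y in porbit p x].
have r_in x : r x \in porbit p x.
  by rewrite /r; case: pickP => [y|/(_ x)] //=; rewrite porbit_id.
have r_p x : r (p x) = r x.
  have e : porbit p (p x) = porbit p x by apply: (porbit_perm p 1).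
  by rewrite /r e; case: pickP => // /(_ x); rewrite porbit_id.
have idxP x : {j | (p ^+ j)%g (r x) = x}.
  apply: sig_eqW; have := r_in x; rewrite porbit_sym.
  by move=> /porbitP[j {2}->]; exists j.
pose idx x := sval (idxP x).
have idxE x : (p ^+ idx x)%g (r x) = x by apply: (svalP (idxP x)).
have F_eq x i j : (p ^+ i)%g x = (p ^+ j)%g x -> F x i = F x j.
  wlog le_ij : i j / i <= j => [W|] e.
    by have [/W|/ltnW/W] := leqP i j; [apply | move/(_ (esym e))].
  rewrite -(subnKC le_ij) FD [X in (_ + X)%R]F_fix ?GRing.addr0 //.
  by rewrite -permM -expgnDr subnKC.
exists (fun x => F (r x) (idx x)) => x.
have -> : F (r (p x)) (idx (p x)) = F (r x) (idx x).+1.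
  by rewrite r_p; apply: F_eq; rewrite -{1}r_p idxE expgSr permM idxE.
by rewrite -addn1 FD idxE /F big_ord1 expg0 perm1 GRing.addrC GRing.addKr.
Qed.

(** * Cycle type and conjugacy in symmetric groups *)

Section CycleType.
Variable T : finType.
Implicit Types s t : {perm T}.

Lemma cycle_type_eqP s t :
  reflect (cycle_type s = cycle_type t)
    (perm_eq [seq #|pred_of_set c| | c in porbits s]
             [seq #|pred_of_set c| | c in porbits t]).
Proof.
apply: perm_sortP => [m n|m n p|m n]; [exact: leq_total| |].
  by move=> /= ? ?; apply: leq_trans; eauto.
by move=> ?; apply/eqP; rewrite eqn_leq andbC.
Qed.

Lemma porbitJ s t x : porbit (s ^ t)%g (t x) = [set t y | y in porbit s x].
Proof.
apply/setP=> y; apply/porbitP/imsetP => [[i ->]|[_ /porbitP[i ->] ->]].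
  by exists ((s ^+ i)%g x); [apply: mem_porbit | rewrite -conjXg permJ].
by exists i; rewrite -conjXg permJ.
Qed.

Lemma cycle_typeJ s t : cycle_type (s ^ t)%g = cycle_type s.
Proof.
pose im (c : {set T}) := [set t y | y in c].
have im_inj : injective im by apply: imset_inj; apply: perm_inj.
apply/cycle_type_eqP.
have -> : porbits (s ^ t)%g = [set im c | c in porbits s].
  apply/setP=> c; apply/imsetP/imsetP => [[x _ ->]|[_ /imsetP[x _ ->] ->]].
    exists (porbit s (t^-1 x)%g); first exact: imset_f.
    by rewrite /im -porbitJ permKV.
  by exists (t x); rewrite ?inE // porbitJ.
have /perm_map e : perm_eq (enum [set im c | c in porbits s])
                           [seq im c | c <- enum (porbits s)].
  apply: uniq_perm; rewrite ?enum_uniq ?map_inj_uniq ?enum_uniq // => c.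
  rewrite mem_enum; apply/imsetP/mapP => -[d ds ->]; exists d => //.
    by rewrite mem_enum.
  by rewrite -mem_enum.
apply: perm_trans (e _ _) _; rewrite -map_comp.
rewrite (eq_map (_ : _ =1 fun c : {set T} => #|c|)) // => c /=.
by rewrite card_imset //; apply: perm_inj.
Qed.

Lemma perm_fix_expg s x i : ((s ^+ i)%g x == x) = (#|porbit s x| %| i).
Proof.
set m := #|_|; have m_gt0 : 0 < m by rewrite lt0n card_porbit_neq0.
have smx : (s ^+ m)%g x = x by rewrite permX iter_porbit.
have smM j : (s ^+ (m * j))%g x = x.
  by elim: j => [|j IHj]; rewrite ?muln0 ?perm1 // mulnS expgnDr permM smx.
rewrite {1}(divn_eq i m) mulnC expgnDr permM smM /dvdn.
have lt_im : i %% m < m by rewrite ltn_mod.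
apply/eqP/eqP => [e|->]; last by rewrite perm1.
have := uniq_traject_porbit s x; rewrite -/m => /(uniqP x)/(_ (i %% m) 0).
by rewrite !inE size_traject !nth_traject // -permX e; apply.
Qed.

(** Both equalities say that [i] and [j] agree modulo the common cycle length. Matching [s ^+ i] at
    [x] with [t ^+ i] at [y] is therefore well defined and injective. *)
Lemma eq_expg_porbit s t x y i j : #|porbit s x| = #|porbit t y| ->
  (s ^+ i)%g x = (s ^+ j)%g x -> (t ^+ i)%g y = (t ^+ j)%g y.
Proof.
move=> st; wlog le_ij : i j / i <= j => [W|] e.
  by have [/W|/ltnW/W] := leqP i j; [apply | move/(_ (esym e))].
move: e; rewrite -(subnK le_ij) !expgnDr !permM => /perm_inj/esym/eqP.
by rewrite perm_fix_expg st -perm_fix_expg => /eqP ->.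
Qed.

(** After a length-preserving matching [be] of the cycles and a choice of base points in matched
    cycles, [u] sends the point that [s ^+ i] reaches from one base point to the point that [t ^+ i]
    reaches from the other. *)
Lemma cycle_type_conj s t :
  cycle_type s = cycle_type t -> exists u, t = (s ^ u)%g.
Proof.
move/cycle_type_eqP => st.
have [be [be_inj be_im be_card]] : exists be : {set T} -> {set T},
    [/\ {in porbits s &, injective be},
     forall c, c \in porbits s -> be c \in porbits t
     & forall c, c \in porbits s -> #|be c| = #|c| ].
  set cs := enum (porbits s); set ct := enum (porbits t).
  (* [Is] permutes positions: cycle number [i] of [s] goes to the cycle of [t] whose number is entry
     [i] of [Is]. *)
  have /(perm_iotaP 0) [Is pI eI] := st.
  have uI : uniq Is by rewrite (perm_uniq pI) iota_uniq.
  have sz : size Is = size cs by have /(congr1 size) := eI; rewrite !size_map.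
  have szt : size cs = size ct by have /perm_size := st; rewrite !size_map.
  have ltI i : i < size cs -> nth 0 Is i < size ct.
    move=> lti; have /(mem_nth 0) : i < size Is by rewrite sz.
    by rewrite (perm_mem pI) mem_iota size_map.
  have idx c : c \in porbits s -> index c cs < size cs.
    by move=> cs_c; rewrite index_mem mem_enum.
  exists (fun c => nth finset.set0 ct (nth 0 Is (index c cs))); split.
  - move=> c d cc dd /eqP.
    rewrite nth_uniq ?enum_uniq ?ltI ?idx // nth_uniq ?sz ?idx // => /eqP.
    move=> e; rewrite -[c](@nth_index _ finset.set0 _ cs) ?mem_enum // e.
    by rewrite nth_index ?mem_enum.
  - by move=> c /idx ic; rewrite -mem_enum mem_nth ?ltI.
  - move=> c cc; have ic := idx _ cc.
    have := congr1 (fun r => nth 0 r (index c cs)) eI.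
    rewrite (nth_map finset.set0) // nth_index ?mem_enum // (nth_map 0) ?sz //.
    by rewrite (nth_map finset.set0) ?ltI // => ->.
(* Here [x] is a default: for nonempty [c] the choice depends on [c] alone. *)
pose rep (c : {set T}) x := odflt x [pick y in c].
have rep_in (c : {set T}) x : x \in c -> rep c x \in c.
  by rewrite /rep; case: pickP => [y|->].
have rep_eq (c : {set T}) x y : x \in c -> rep c x = rep c y.
  by rewrite /rep; case: pickP => [//|->].
pose r x := rep (porbit s x) x; pose r' x := rep (be (porbit s x)) x.
have porb x : porbit s x \in porbits s by apply: imset_f.
have r_in x : x \in porbit s (r x) by rewrite porbit_sym rep_in ?porbit_id.
have idxP x : {j | (s ^+ j)%g (r x) = x}.
  by apply: sig_eqW; have /porbitP[j {2}->] := r_in x; exists j.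
pose idx x := sval (idxP x).
have idxE x : (s ^+ idx x)%g (r x) = x by apply: (svalP (idxP x)).
have r'_in x : r' x \in be (porbit s x).
  have /imsetP[y _ ey] := be_im _ (porb x).
  by rewrite /r' -(@rep_eq _ y) ?rep_in ?ey ?porbit_id.
have r'_orb x : porbit t (r' x) = be (porbit s x).
  have /imsetP[y _ ey] := be_im _ (porb x).
  by apply/eqP; rewrite ey eq_porbit_mem -ey.
have r_orb x : porbit s (r x) = porbit s x.
  by apply/eqP; rewrite eq_sym eq_porbit_mem.
have r_eq x y : porbit s x = porbit s y -> r x = r y.
  by rewrite /r => <-; apply: rep_eq; apply: porbit_id.
have r'_eq x y : porbit s x = porbit s y -> r' x = r' y.
  move=> e; have /imsetP[z _ ez] := be_im _ (porb x).
  by rewrite /r' -e -!(@rep_eq _ z) ?ez ?porbit_id.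
pose u x := (t ^+ idx x)%g (r' x).
have u_s x : u (s x) = t (u x).
  have e : porbit s (s x) = porbit s x by apply: (porbit_perm s 1).
  rewrite /u (r'_eq _ _ e) -permM -expgSr.
  apply: (eq_expg_porbit (s := s) (x := r x)).
    by rewrite r_orb r'_orb be_card.
  by rewrite -{1}(r_eq _ _ e) idxE expgSr permM idxE.
have u_inj : injective u.
  move=> x y exy.
  have e : porbit s x = porbit s y.
    apply: be_inj => //; rewrite -!r'_orb.
    rewrite -(porbit_perm t (idx x) (r' x)) -(porbit_perm t (idx y) (r' y)).
    by rewrite -/(u x) exy.
  rewrite -[x]idxE -[y]idxE -(r_eq _ _ e).
  apply: (eq_expg_porbit (s := t) (x := r' x)).
    by rewrite r_orb r'_orb be_card.
  by rewrite -[LHS]/(u x) exy /u (r'_eq _ _ e).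
exists (perm u_inj); apply/permP=> z; rewrite -[z](permKV (perm u_inj)).
by rewrite permJ !permE u_s.
Qed.
End CycleType.

(** * A semidirect product with integer coordinates, used to detect the kernel *)

Section ConjWreath.
Variable gT : finGroupType.

(* The semidirect product Z^gT >< gT, with gT acting on its own elements by
   conjugation. *)
Definition conj_wreath : Type := ({ffun gT -> int} * gT)%type.
HB.instance Definition _ := Choice.on conj_wreath.
Implicit Types p q : conj_wreath.

Definition wreath_one : conj_wreath := (0%R, 1%g).
Definition wreath_mul p q : conj_wreath :=
  ([ffun x => p.1 x + q.1 (x ^ p.2)%g]%R, (p.2 * q.2)%g).
Definition wreath_inv p : conj_wreath :=
  ([ffun x => - p.1 (x ^ p.2^-1)%g]%R, (p.2^-1)%g).

Lemma wreath_mulA : associative wreath_mul.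
Proof.
move=> [u r] [v s] [w t]; congr (_, _); rewrite /= ?mulgA //.
by apply/ffunP=> x; rewrite !ffunE /= conjgM GRing.addrA.
Qed.

Lemma wreath_mul1 : left_id wreath_one wreath_mul.
Proof.
move=> [v s]; congr (_, _); rewrite /= ?mul1g //.
by apply/ffunP=> x; rewrite !ffunE conjg1 GRing.add0r.
Qed.

Lemma wreath_mulr1 : right_id wreath_one wreath_mul.
Proof.
move=> [v s]; congr (_, _); rewrite /= ?mulg1 //.
by apply/ffunP=> x; rewrite !ffunE GRing.addr0.
Qed.

Lemma wreath_mulV : left_inverse wreath_one wreath_inv wreath_mul.
Proof.
move=> [v s]; congr (_, _); rewrite /= ?mulVg //.
by apply/ffunP=> x; rewrite !ffunE /= GRing.addNr.
Qed.

Lemma wreath_mulrV : right_inverse wreath_one wreath_inv wreath_mul.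
Proof.
move=> [v s]; congr (_, _); rewrite /= ?mulgV //.
by apply/ffunP=> x; rewrite !ffunE /= conjgK GRing.addrN.
Qed.

HB.instance Definition _ := isGroup.Build conj_wreath
  wreath_mulA wreath_mul1 wreath_mulr1 wreath_mulV wreath_mulrV.

Lemma wreathM p q : (p * q)%g = wreath_mul p q. Proof. by []. Qed.

Definition delta (t : gT) : {ffun gT -> int} := [ffun x => (x == t)%:R]%R.

Lemma wreath_conj v p :
  (((v, 1) : conj_wreath) ^ p = ([ffun x => v (x ^ p.2^-1)], 1)
     :> conj_wreath)%g.
Proof.
case: p => w s; rewrite conjgE !wreathM /wreath_mul /wreath_inv /=.
congr (_, _); last by rewrite mul1g mulVg.
by apply/ffunP=> x; rewrite !ffunE /= conjg1 GRing.addrC GRing.addrK.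
Qed.

(** The first coordinate is the norm of [v] under the powers of [s]; it vanishes when the [k]-th
    power is trivial. *)
Lemma wreath_exp v s k :
  (((v, s) : conj_wreath) ^+ k
     = ([ffun x => \sum_(i < k) v (x ^ (s ^+ i))%g]%R, s ^+ k)
     :> conj_wreath)%g.
Proof.
elim: k => [|k IHk].
  by congr (_, _); apply/ffunP=> x; rewrite !ffunE big_ord0.
rewrite expgSr IHk wreathM /wreath_mul /= -expgSr; congr (_, _).
by apply/ffunP=> x; rewrite !ffunE big_ord_recr.
Qed.
End ConjWreath.

(** * Normal forms modulo squares of generators *)

Section NormalForm.
Variables (G : groupType) (n : nat) (g : nat -> G) (N : normalSubgroup G).
Local Open Scope group_scope.
Hypothesis gC : forall i j, i.+2 <= j -> commute (g i) (g j).
Hypothesis gB : forall i, i.+1 < n ->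
  g i.+1 * g i * g i.+1 = g i * g i.+1 * g i.
Hypothesis Ngg : forall i, nset N (g i * g i).

Fixpoint desc j l := if l is l'.+1 then g (j + l') * desc j l' else 1.

Lemma descSr j l : desc j l.+1 = desc j.+1 l * g j.
Proof.
elim: l => [|l IHl] /=; first by rewrite addn0 mulg1 mul1g.
by rewrite /= in IHl; rewrite IHl mulgA addSnnS.
Qed.

Lemma descC j l i : i.+2 <= j -> desc j l * g i = g i * desc j l.
Proof.
move=> ij; elim: l => [|l IHl] /=; first by rewrite mulg1 mul1g.
have c : commute (g i) (g (j + l)) by apply: gC; lia.
by rewrite -mulgA IHl !mulgA c.
Qed.

Lemma descCr j l i : j + l < i -> desc j l * g i = g i * desc j l.
Proof.
elim: l => [|l IHl] jli /=; first by rewrite mulg1 mul1g.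
have c : commute (g (j + l)) (g i) by apply: gC; lia.
by rewrite -mulgA IHl ?mulgA ?c //; lia.
Qed.

(** Moving left, [g i] passes the letters below [i.-1], becomes [g i.-1] by the braid relation at
    [g i * g i.-1], and then passes the letters above [i]. *)
Lemma desc_shift j l i : j + l <= n -> j < i -> i < j + l ->
  desc j l * g i = g i.-1 * desc j l.
Proof.
move=> jln ji; elim: l jln => [|l IHl] jln ijl; first by lia.
case: (ltnP i (j + l)) => [ltij|geij] /=.
  have c : commute (g i.-1) (g (j + l)) by apply: gC; lia.
  by rewrite -mulgA IHl ?mulgA ?c //; lia.
have {geij ijl} ei : i = j + l by lia.
case: l => [|l] in ei IHl jln *; first by lia.
have b := @gB (j + l); have ei' : i = (j + l).+1 by lia.
rewrite /= addnS ei' /= -!mulgA descCr ?mulgA ?b //; lia.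
Qed.

(* The words [desc j l] = g_m ... g_j with [j + l = m.+1] represent the cosets
   of S_(m+1) in S_(m+2). *)
Inductive coset_form : nat -> G -> Prop :=
| CosetForm0 p : nset N p -> coset_form 0 p
| CosetFormS m h j l : coset_form m h -> (j + l = m.+1)%N ->
    coset_form m.+1 (h * desc j l).

Lemma coset_formN m h p : nset N p -> coset_form m h -> coset_form m (p * h).
Proof.
move=> Np; elim=> [q Nq|{}m {}h j l _ IHh jl].
  by constructor; apply: nsetM.
by rewrite mulgA; constructor.
Qed.

Lemma coset_formNr m h p : nset N p -> coset_form m h -> coset_form m (h * p).
Proof.
move=> Np; rewrite conjgCV; apply: coset_formN; exact: nset_conj.
Qed.

(** The last factor [desc j l] decides: [g i] commutes past it if [i.+1 < j], prolongs it if
    [i.+1 = j], cancels its last letter up to [N] if [i = j], and crosses it as [g i.-1] if [j < i].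
    When it gets past, induction applies to the prefix. *)
Lemma coset_form_gen m h i :
  i < m <= n -> coset_form m h -> coset_form m (h * g i).
Proof.
move=> im hm; elim: hm i im => [p _ i|{}m {}h j l hm IHh jl i im]; first by lia.
case: (ltngtP i.+1 j) => [lt_ij|lt_ji|eij].
- rewrite -mulgA descC // mulgA; constructor=> //; apply: IHh; lia.
- case: (ltngtP i j) => [|lt_ji'|eij]; first by lia.
    rewrite -mulgA desc_shift ?mulgA; try lia.
    constructor=> //; apply: IHh; lia.
  case: l => [|l] in jl *; first by lia.
  rewrite descSr eij -mulgA -[_ * g j * g j]mulgA mulgA.
  apply: coset_formNr => //; constructor=> //; lia.
- rewrite -eij -mulgA -descSr; constructor=> //; lia.
Qed.

Lemma coset_form_genV m h i :
  i < m <= n -> coset_form m h -> coset_form m (h * (g i)^-1).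
Proof.
move=> im hm; rewrite -[X in _ * X](mulgKV (g i)) -invgM mulgA.
by apply: coset_form_gen => //; apply: coset_formNr => //; apply: nsetV.
Qed.

(** Here [n] counts the generators. The elements whose right multiplication preserves and reflects
    normal forms make up a subgroup [C] containing them, and 1 has a normal form. *)
Lemma coset_form_total :
  (forall C : set G, is_subgroup C -> (forall i, i < n -> C (g i)) ->
     C = setT) ->
  forall x, coset_form n x.
Proof.
move=> genG x.
(* The equivalence, stronger than an implication, makes [C] closed under inverses. *)
pose C : set G := fun y => forall h, coset_form n h <-> coset_form n (h * y).
suff CT : C = setT.
  have /(_ 1) : C x by rewrite CT.
  rewrite mul1g => -[+ _]; apply; elim: n => [|m IHm].
    by constructor; apply: nset1.
  by rewrite -[1]mulg1; apply: (@CosetFormS m 1 m.+1 0) => //; rewrite addn0.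
apply: genG => [|i lt_in h].
  split=> [h|y z Cy Cz h]; first by rewrite mulg1.
  have [] := (Cy h, Cz (h * (y / z))); rewrite -(mulgA h) mulgVK.
  by move=> [? ?] [? ?]; split; auto.
split; first by apply: coset_form_gen; lia.
by move=> hg; rewrite -[h](mulgK (g i)); apply: coset_form_genV => //; lia.
Qed.
End NormalForm.

(** * Reading the letters of a normal form off its permutation *)

Section Threshold.
Variables (G : groupType) (n : nat) (g : nat -> G) (N : normalSubgroup G).
Variable rho : G -> 'S_n.
Local Open Scope group_scope.
Hypothesis rhoM : {morph rho : x y / x * y}.
Hypothesis rhoN : forall p, nset N p -> rho p = 1.
Hypothesis rho_g : forall i (x : 'I_n), i.+1 < n ->
  rho (g i) x = (if x == i :> nat then i.+1
                 else if x == i.+1 :> nat then i else x) :> nat.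

Let rho1 : rho 1 = 1.
Proof. exact/rhoN/nset1. Qed.

Lemma desc_top j l (x : 'I_n) :
  x = j + l :> nat -> rho (desc g j l) x = j :> nat.
Proof.
elim: l x => [|l IHl] x xE /=; first by rewrite rho1 perm1; lia.
have := ltn_ord x => lt_xn; rewrite rhoM permM; apply: IHl.
by rewrite rho_g; do ?case: eqP; lia.
Qed.

Lemma desc_fix j l (x : 'I_n) :
  j + l < n -> (x < j) || (j + l < x) -> rho (desc g j l) x = x.
Proof.
elim: l x => [|l IHl] x jln xjl /=; first by rewrite rho1 perm1.
rewrite rhoM permM (_ : rho (g (j + l)) x = x) ?IHl //; try lia.
by apply: val_inj; rewrite /= rho_g; do ?case: eqP; lia.
Qed.

Lemma coset_form_fix m h (x : 'I_n) :
  coset_form g N m h -> m < n -> m < x -> rho h x = x.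
Proof.
elim=> [p Np _ _|{}m {}h j l _ IHh jl mn mx]; first by rewrite rhoN ?perm1.
by rewrite rhoM permM IHh ?desc_fix //; lia.
Qed.

(** The point [m.+1] is fixed by the prefix and sent to [j] by the last factor [desc j l]. So the
    bound gives [f m.+1 <= j], and all letters of that factor lie in [C]. *)
Lemma coset_form_threshold (f : nat -> nat) (C : G -> Prop) m h :
    {homo f : i j / i <= j} ->
    (forall p, nset N p -> C p) -> (forall x y, C x -> C y -> C (x * y)) ->
    (forall i j, i.+1 < n -> f i.+1 <= j <= i -> C (g j)) ->
    coset_form g N m h -> m < n ->
    (forall x : 'I_n, x <= m -> f x <= rho h x) ->
  C h.
Proof.
move=> f_homo CN CM Cg.
elim=> [p Np _ _|{}m {}h j l hm IHh jl mn le_f]; first exact: CN.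
pose top := Ordinal mn.
have le_fj : f m.+1 <= j.
  have := le_f top (leqnn _).
  rewrite rhoM permM (coset_form_fix (x := top) hm (ltnW mn)) //.
  by rewrite (desc_top (j := j) (l := l)).
have Cdesc l' : l' <= l -> C (desc g j l').
  elim: l' => [|l' IHl'] le_l /=; first exact/CN/nset1.
  apply: CM; last by apply: IHl'; lia.
  by apply: (Cg m) => //; lia.
apply: CM; last exact: Cdesc.
apply: IHh => [|x le_xm]; first by lia.
have le_fx : f x <= f m.+1 by apply: f_homo; lia.
(* The prefix inherits the bound: an image below [j] is fixed by the last factor, and any other
   image is at least [f m.+1], hence at least [f x]. *)
case: (ltnP (rho h x) j) => [lt_j|]; last first.
  by apply: leq_trans; apply: leq_trans le_fj.
have := le_f x (leqW le_xm); rewrite rhoM permM desc_fix ?lt_j //; lia.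
Qed.
End Threshold.

(** * Generators and relations in B_n/[P_n, P_n] *)

Section CrystalGenerators.
Variable n : nat.
Local Open Scope group_scope.

Definition crystal_pi : braid n -> crystal_braid n :=
  quot_pi (commutator_normal (pure_braid n)).

Lemma crystal_piM : {morph crystal_pi : x y / x * y}.
Proof. exact: quot_piM. Qed.

Lemma crystal_pi1 : crystal_pi 1 = 1. Proof. by []. Qed.

HB.instance Definition _ :=
  isUMagmaMorphism.Build (braid n) (crystal_braid n)
    crystal_pi (crystal_pi1, crystal_piM).

(* Out-of-range indices give [1], so that the commutation relations hold for
   all indices. *)
Definition crystal_gen (i : nat) : crystal_braid n :=
  if insub i is Some j then crystal_pi (braid_gen j) else 1.

Lemma crystal_genE (i : 'I_n.-1) : crystal_gen i = crystal_pi (braid_gen i).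
Proof. by rewrite /crystal_gen valK. Qed.

Lemma crystal_gen_comm i j :
  i.+2 <= j -> commute (crystal_gen i) (crystal_gen j).
Proof.
rewrite /commute /crystal_gen => ij.
case: insubP => [a _ ai|_]; last by rewrite mul1g mulg1.
case: insubP => [b _ bj|_]; last by rewrite mul1g mulg1.
rewrite -!crystal_piM; congr (crystal_pi _); rewrite -!of_wordM /=.
by apply/of_wordP/word_eq_rel/braid_comm; rewrite ai bj ij.
Qed.

Lemma crystal_gen_braid i : i.+1 < n.-1 ->
  crystal_gen i.+1 * crystal_gen i * crystal_gen i.+1
    = crystal_gen i * crystal_gen i.+1 * crystal_gen i.
Proof.
move=> lt_i; rewrite /crystal_gen.
case: insubP => [b _ bi|]; last by rewrite lt_i.
case: insubP => [a _ ai|]; last by rewrite ltnW.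
rewrite -!crystal_piM; congr (crystal_pi _).
rewrite -[_ * braid_gen a in LHS]of_wordM -[_ * braid_gen b in RHS]of_wordM.
rewrite -!of_wordM.
by apply/of_wordP/word_eq_rel/braid_braid; rewrite bi ai.
Qed.

Lemma crystal_gen_total (C : set (crystal_braid n)) :
  is_subgroup C -> (forall i, i < n.-1 -> C (crystal_gen i)) -> C = setT.
Proof.
move=> [C1 CF] Cg.
have CV x : C x -> C x^-1 by move=> Cx; rewrite -[_^-1]mul1g; apply: CF.
have CM x y : C x -> C y -> C (x * y).
  by move=> Cx /CV Cy; rewrite -[y]invgK; apply: CF.
apply/seteqP; split=> // q _.
rewrite -(quot_pi_repr q) -(of_word_repr (repr q)) -/(crystal_pi _).
elim: (repr (repr q : braid n)) => [|[i b] w IHw]; first exact: C1.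
rewrite -cat1s of_wordM crystal_piM; apply: CM => //.
have Ci : C (crystal_pi (braid_gen i)) by rewrite -crystal_genE; apply: Cg.
case: b => //.
suff -> : of_word (@braid_rels n) [:: (i, false)] = (braid_gen i)^-1 :> braid n.
  by rewrite gmulfV; apply: CV.
by rewrite [RHS](of_word_inv (braid_rels (n:=n))).
Qed.

Lemma sigma_bar_gen i (x : 'I_n) : i.+1 < n ->
  sigma_bar (crystal_gen i) x = (if x == i :> nat then i.+1
                                 else if x == i.+1 :> nat then i else x) :> nat.
Proof.
move=> lt_in; have lt_i : i < n.-1 by lia.
rewrite -[i]/(val (Ordinal lt_i)) crystal_genE sigma_bar_pi sigma_gen.
rewrite /adj_tperm.
by case: tpermP => [->|->|/eqP + /eqP]; rewrite /= -?val_eqE /= ?eqxx;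
  do ?case: eqP; lia.
Qed.

Lemma crystal_ker_comm (x y : crystal_braid n) :
  sigma_bar x = 1 -> sigma_bar y = 1 -> commute x y.
Proof.
rewrite -(quot_pi_repr x) -(quot_pi_repr y) !sigma_bar_pi => Px Py.
apply/commgP/eqP.
rewrite -/(crystal_pi _) -/(crystal_pi _) -gmulfR -crystal_pi1.
apply/esym/quot_piP; rewrite invg1 mul1g; apply: sub_subgroup_gen.
by exists (repr x), (repr y).
Qed.

(** * The homomorphism to Z^(S_n) >< S_n *)

Definition wreath_gen (i : 'I_n.-1) : conj_wreath 'S_n :=
  (delta (adj_tperm i), adj_tperm i).

(** Second coordinates satisfy the relations in ['S_n]. In the first ones, both sides of the braid
    relation sum [delta] over the same three transpositions: those of [i] and [j], and the conjugate
    of either by the other. *)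
Lemma wreath_gen_rels : respects_rels (braid_rels (n := n)) wreath_gen.
Proof.
have eqJ (x y s : 'S_n) : (x ^ s == y) = (x == y ^ s^-1).
  exact: can2_eq (conjgK s) (conjgKV s) _ _.
have inv i : (@adj_tperm n i)^-1 = adj_tperm i by rewrite tpermV.
move=> u v uv; have := adj_tperm_rels uv.
case: uv => [i j _|i j _]; rewrite /word_eval !big_cons !big_nil /= !mulg1 => e;
  rewrite !wreathM; congr (_, _) => //=; apply/ffunP=> x;
  rewrite !ffunE /= -?conjgM !eqJ.
  have /conjg_fixP c : [~ adj_tperm j, adj_tperm i] == 1 by apply/commgP/esym.
  have /conjg_fixP c' : [~ adj_tperm i, adj_tperm j] == 1 by apply/commgP.
  by rewrite !inv c c' GRing.addrC.
have braidJ (a b : 'S_n) : a^-1 = a -> b^-1 = b -> b * (a * b) = a * (b * a) ->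
    b ^ (a * b) = a /\ b ^ a = a ^ b.
  move=> ia ib ab; split; last by rewrite !conjgE ia ib ab.
  by rewrite conjgE invgM ia ib ab -mulgA -{1}ib -{1}ia !mulKg.
rewrite !invgM !inv; have [-> ->] := braidJ _ _ (inv i) (inv j) e.
have [-> _] := braidJ _ _ (inv j) (inv i) (esym e).
by rewrite [LHS]GRing.addrC -GRing.addrA [RHS]GRing.addrCA.
Qed.

Definition wreath_rep : braid n -> conj_wreath 'S_n := pres_lift wreath_gen.

Lemma wreath_repM : {morph wreath_rep : x y / x * y}.
Proof. exact: pres_liftM wreath_gen_rels. Qed.

Lemma wreath_rep1 : wreath_rep 1 = 1.
Proof. by apply: (mulgI (wreath_rep 1)); rewrite -wreath_repM !mulg1. Qed.

HB.instance Definition _ := isUMagmaMorphism.Build (braid n) (conj_wreath 'S_n)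
  wreath_rep (wreath_rep1, wreath_repM).

Lemma wreath_rep_sigma b : (wreath_rep b).2 = sigma b.
Proof.
rewrite /wreath_rep /sigma -(of_word_repr b).
rewrite (pres_lift_of_word wreath_gen_rels).
rewrite (pres_lift_of_word (@adj_tperm_rels n)).
rewrite /word_eval; elim: (repr b) => [|[i []] w IHw].
  by rewrite !big_nil.
  by rewrite !big_cons -IHw.
by rewrite !big_cons -IHw.
Qed.

(** Pure braids land in the abelian subgroup Z^(S_n), where commutators vanish. *)
Lemma wreath_rep_comm b :
  commutator_subgroup (pure_braid n) b -> wreath_rep b = 1.
Proof.
apply: (@subgroup_gen_min _ _ (fun b => wreath_rep b = 1)).
  by split=> [|x y x1 y1]; rewrite /= ?wreath_rep1 // gmulfF /= x1 y1 divg1.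
move=> _ [x [y [Px Py ->]]] /=; rewrite gmulfR /=; apply/eqP/commgP.
case: (wreath_rep x) (wreath_rep_sigma x) => v s /= ->.
case: (wreath_rep y) (wreath_rep_sigma y) => w t /= ->.
rewrite /commute !wreathM Px Py; congr (_, _) => /=.
by apply/ffunP=> z; rewrite !ffunE /= !conjg1 GRing.addrC.
Qed.

Definition crystal_wreath (q : crystal_braid n) : conj_wreath 'S_n :=
  wreath_rep (repr q).

Lemma crystal_wreath_pi b : crystal_wreath (crystal_pi b) = wreath_rep b.
Proof.
have /quot_piP/wreath_rep_comm := quot_pi_repr (crystal_pi b).
by rewrite gmulfM gmulfV => /(canRL (mulKVg _)); rewrite mulg1.
Qed.

Lemma crystal_wreathM : {morph crystal_wreath : x y / x * y}.
Proof.
move=> x y; rewrite -[x in LHS]quot_pi_repr -[y in LHS]quot_pi_repr.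
rewrite -crystal_piM.
by rewrite crystal_wreath_pi wreath_repM.
Qed.

Lemma crystal_wreath1 : crystal_wreath 1 = 1.
Proof. by rewrite -crystal_pi1 crystal_wreath_pi wreath_rep1. Qed.

HB.instance Definition _ :=
  isUMagmaMorphism.Build (crystal_braid n) (conj_wreath 'S_n)
    crystal_wreath (crystal_wreath1, crystal_wreathM).

Lemma crystal_wreath_sigma q : (crystal_wreath q).2 = sigma_bar q.
Proof. exact: wreath_rep_sigma. Qed.

(** * The kernel of [sigma_bar] as an additive group *)

Definition crystal_kernel := {q : crystal_braid n | sigma_bar q == 1}.
HB.instance Definition _ := SubChoice.on crystal_kernel.
Implicit Types m : crystal_kernel.

Lemma crystal_kernelP m : sigma_bar (val m) = 1.
Proof. exact: (eqP (valP m)). Qed.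

Lemma kernel_zero_proof : sigma_bar (1 : crystal_braid n) == 1.
Proof. by rewrite sigma_bar1. Qed.
Lemma kernel_opp_proof m : sigma_bar (val m)^-1 == 1.
Proof. by rewrite gmulfV /= crystal_kernelP invg1. Qed.
Lemma kernel_add_proof m1 m2 : sigma_bar (val m1 * val m2) == 1.
Proof. by rewrite gmulfM /= !crystal_kernelP mulg1. Qed.
Lemma kernel_conj_proof h m : sigma_bar (val m ^ h) == 1.
Proof. by rewrite gmulfJ /= crystal_kernelP conj1g. Qed.

Definition kernel_zero : crystal_kernel :=
  exist (fun q => sigma_bar q == 1) _ kernel_zero_proof.
Definition kernel_opp m : crystal_kernel :=
  exist (fun q => sigma_bar q == 1) _ (kernel_opp_proof m).
Definition kernel_add m1 m2 : crystal_kernel :=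
  exist (fun q => sigma_bar q == 1) _ (kernel_add_proof m1 m2).
Definition kernel_conj h m : crystal_kernel :=
  exist (fun q => sigma_bar q == 1) _ (kernel_conj_proof h m).

Lemma kernel_addA : associative kernel_add.
Proof. by move=> x y z; apply: val_inj; rewrite /= mulgA. Qed.
Lemma kernel_addC : commutative kernel_add.
Proof.
by move=> x y; apply/val_inj/crystal_ker_comm; apply: crystal_kernelP.
Qed.
Lemma kernel_add0 : left_id kernel_zero kernel_add.
Proof. by move=> x; apply: val_inj; rewrite /= mul1g. Qed.
Lemma kernel_addN : left_inverse kernel_zero kernel_opp kernel_add.
Proof. by move=> x; apply: val_inj; rewrite /= mulVg. Qed.

HB.instance Definition _ := GRing.isZmodule.Build crystal_kernel
  kernel_addA kernel_addC kernel_add0 kernel_addN.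

Lemma kernel_conj_is_zmod h : GRing.zmod_morphism (kernel_conj h).
Proof. by move=> x y; apply: val_inj; rewrite /= conjMg conjVg. Qed.
HB.instance Definition _ h :=
  GRing.isZmodMorphism.Build crystal_kernel crystal_kernel
    (kernel_conj h) (kernel_conj_is_zmod h).

End CrystalGenerators.

(** * The kernel is the normal closure of the squares of generators *)

Section CrystalConjugacy.
Variable n : nat.
Hypothesis n_ge3 : 3 <= n.
Local Open Scope group_scope.
Local Notation g := (@crystal_gen n).

Definition square_conjugates : set (crystal_braid n) :=
  fun z => exists i h, z = (g i * g i) ^ h.

Lemma square_closure_conj (x : crystal_braid n) h :
  subgroup_gen square_conjugates x -> subgroup_gen square_conjugates (x ^ h).
Proof.
have [S1 SF] := subgroup_gen_subgroup square_conjugates.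
apply: (@subgroup_gen_min _ _
  (fun z => subgroup_gen square_conjugates (z ^ h))).
  by split=> [|y z Sy Sz]; rewrite /= ?conj1g // conjMg conjVg; apply: SF.
move=> _ [i [k ->]]; rewrite /= -conjgM; apply: sub_subgroup_gen.
by exists i, (k * h).
Qed.

Definition square_closure : normalSubgroup (crystal_braid n) :=
  NormalSubgroup (subgroup_gen_subgroup _) square_closure_conj.

Lemma sigma_bar_square i : sigma_bar (g i * g i) = 1.
Proof.
have [lt_i|ge_i] := ltnP i n.-1.
  rewrite -[i]/(val (Ordinal lt_i)) crystal_genE sigma_barM !sigma_bar_pi.
  by rewrite sigma_gen tperm2.
by rewrite /crystal_gen insubF ?mulg1 ?sigma_bar1 // ltnNge ge_i.
Qed.

Lemma sigma_bar_square_closure x : nset square_closure x -> sigma_bar x = 1.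
Proof.
apply: (@subgroup_gen_min _ _ (fun x => sigma_bar x = 1)).
  by split=> [|y z y1 z1]; rewrite /= ?sigma_bar1 // gmulfF /= y1 z1 divg1.
by move=> _ [i [h ->]]; rewrite gmulfJ /= sigma_bar_square conj1g.
Qed.

Lemma sigma_bar_threshold (f : nat -> nat) (C : crystal_braid n -> Prop) x :
    {homo f : i j / i <= j} ->
    (forall p, nset square_closure p -> C p) ->
    (forall y z, C y -> C z -> C (y * z)) ->
    (forall i j, i.+1 < n -> f i.+1 <= j <= i -> C (g j)) ->
    (forall a : 'I_n, f a <= sigma_bar x a) ->
  C x.
Proof.
move=> f_homo CN CM Cg le_f.
have Ngg i : nset square_closure (g i * g i).
  by apply: sub_subgroup_gen; exists i, 1; rewrite conjg1.
(* Since [n.-1] is both the number of generators and the largest point, every element has a normal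
   form at this level. *)
apply: (coset_form_threshold (@sigma_barM n) sigma_bar_square_closure
  (@sigma_bar_gen n) f_homo CN CM Cg (m := n.-1)) => //; last by lia.
apply: (coset_form_total (@crystal_gen_comm n) (@crystal_gen_braid n) Ngg).
exact: crystal_gen_total.
Qed.

(** For [f = id] the range [i.+1 <= j <= i] is empty: no letter is admissible, and only the square
    closure remains. *)
Lemma crystal_kernel_square_closure x :
  sigma_bar x = 1 -> nset square_closure x.
Proof.
move=> x1; apply: (sigma_bar_threshold (f := id)) => //; first exact: nsetM.
  by move=> i j _; lia.
by move=> a; rewrite x1 perm1.
Qed.

(** Commuting with the transposition [sigma_bar (g 0)] means preserving its support, hence the
    complement. The threshold then leaves [g 0] and the [g j] with [2 <= j], which commute with
    [g 0], and pure factors, which commute with the square because the kernel is abelian. *)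
Lemma square_centralized x :
  commute (sigma_bar (g 0)) (sigma_bar x) -> commute (g 0 * g 0) x.
Proof.
move=> cx; apply: (sigma_bar_threshold (f := fun a => if a < 2 then 0 else 2)).
- by move=> i j ij /=; case: (ltnP i 2); case: (ltnP j 2); lia.
- move=> p /sigma_bar_square_closure p1.
  by apply: crystal_ker_comm; rewrite ?sigma_bar_square.
- by move=> y z; apply: commuteM.
- move=> [|i] j _ /= ij.
    have -> : j = 0 by lia.
    by rewrite /commute mulgA.
  by apply/commute_sym/commuteM; apply/commute_sym/crystal_gen_comm; lia.
move=> a; case: ltnP => // ge_a.
have ga : sigma_bar (g 0) a = a.
  by apply: val_inj; rewrite /= sigma_bar_gen; do ?case: eqP; lia.
have := congr1 (fun s : 'S_n => s a) cx; rewrite !permM ga => /(congr1 val).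
by rewrite /= sigma_bar_gen; do ?case: eqP; lia.
Qed.

(** * The generators A_ij of the kernel *)

Definition base_square : crystal_kernel n :=
  exist (fun q => sigma_bar q == 1) _ (introT eqP (sigma_bar_square 0)).

(** The element [h * h'^-1] centralizes the transposition in ['S_n], hence also the square. This
    makes [pure_gen] independent of the lift. *)
Lemma kernel_conj_base h h' :
  sigma_bar (g 0) ^ sigma_bar h = sigma_bar (g 0) ^ sigma_bar h' ->
  kernel_conj h base_square = kernel_conj h' base_square.
Proof.
move=> e; apply: val_inj; rewrite /= -[LHS](conjgKV h') -(conjgM _ h).
congr (_ ^ _).
apply/conjg_fixP/commgP/square_centralized; apply/commgP/conjg_fixP.
by rewrite sigma_barM gmulfV /= conjgM e conjgK.
Qed.

(* The class of the standard generator A_ij of P_n, indexed by the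
   transposition (i, j); zero when [t] is not a transposition. *)
Definition pure_gen (t : 'S_n) : crystal_kernel n :=
  if pselect (exists h, sigma_bar (g 0) ^ sigma_bar h = t) is left e
  then kernel_conj (projT1 (cid e)) base_square else 0%R.

Lemma pure_genE h :
  pure_gen (sigma_bar (g 0) ^ sigma_bar h) = kernel_conj h base_square.
Proof.
rewrite /pure_gen; case: pselect => [e|[]]; last by exists h.
by apply: kernel_conj_base; apply: (projT2 (cid e)).
Qed.

(** This is what makes the kernel a permutation module. The value zero off the transpositions is
    consistent, because conjugates of transpositions are transpositions. *)
Lemma pure_gen_conj h t :
  kernel_conj h (pure_gen t) = pure_gen (t ^ sigma_bar h).
Proof.
have [[k <-]|nt] := pselect (exists k, sigma_bar (g 0) ^ sigma_bar k = t).
  rewrite -conjgM -sigma_barM !pure_genE.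
  by apply: val_inj; rewrite /= conjgM.
rewrite /pure_gen; case: pselect => // _.
case: pselect => [[k e]|_]; last exact: GRing.raddf0.
by case: nt; exists (k * h^-1); rewrite sigma_barM gmulfV /= conjgM e conjgK.
Qed.

Definition pure_comb (v : 'S_n -> int) : crystal_kernel n :=
  (\sum_t pure_gen t *~ v t)%R.

Lemma pure_combB v w :
  pure_comb (fun t => v t - w t)%R = (pure_comb v - pure_comb w)%R.
Proof.
by rewrite /pure_comb -GRing.sumrB; apply: eq_bigr => t _; rewrite mulrzBr.
Qed.

Lemma pure_comb_delta t : pure_comb (delta t) = pure_gen t.
Proof.
rewrite /pure_comb (bigD1 t) //= big1 => [|u ut].
  by rewrite ffunE eqxx mulr1z GRing.addr0.
by rewrite ffunE (negPf ut) mulr0z.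
Qed.

Lemma pure_comb_conj h v :
  kernel_conj h (pure_comb v) = pure_comb (fun t => v (t ^ (sigma_bar h)^-1)).
Proof.
rewrite /pure_comb GRing.raddf_sum.
rewrite [RHS](reindex_inj (@conjg_inj _ (sigma_bar h))) /=.
apply: eq_bigr => t _; rewrite -pure_gen_conj conjgK.
exact: raddfMz.
Qed.

(** By the braid relation, conjugation by [g i * g i.+1] takes [g i.+1] to [g i]. *)
Lemma crystal_gen_conj0 i : i < n.-1 -> exists c, g i = g 0 ^ c.
Proof.
elim: i => [|i IHi] lt_i; first by exists 1; rewrite conjg1.
have [c gi] := IHi (ltnW lt_i).
exists (c * (g i * g i.+1)^-1); rewrite conjgM -gi; apply: (canRL (conjgK _)).
rewrite conjgE !invgM -!mulgA [X in _ * (_ * X)]mulgA crystal_gen_braid //.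
by rewrite -mulgA mulKg mulKg.
Qed.

(** Generation and independence at once: [v] gives the coefficients, and [crystal_wreath] recovers
    them up to the factor 2. The property is stable under division, so conjugates of squares
    suffice. *)
Lemma crystal_kernel_comb x : sigma_bar x = 1 ->
  exists v : {ffun 'S_n -> int}, val (pure_comb v) = x /\
    crystal_wreath x = ([ffun t => v t *+ 2]%R, 1).
Proof.
move/crystal_kernel_square_closure.
apply: (@subgroup_gen_min _ _
  (fun x => exists v : {ffun 'S_n -> int}, val (pure_comb v) = x /\
    crystal_wreath x = ([ffun t => v t *+ 2]%R, 1))).
  split=> [|y z [v [vy wy]] [w [wz ww]]].
    exists 0%R; split.
      by rewrite /pure_comb big1 // => t _; rewrite ffunE mulr0z.
    rewrite gmulf1; congr (_, _); apply/ffunP=> t; rewrite !ffunE; lia.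
  exists (v - w)%R; split.
    rewrite (_ : pure_comb _ = pure_comb v - pure_comb w)%R.
      by rewrite -vy -wz.
    by rewrite -pure_combB; apply: eq_bigr => t _; rewrite !ffunE.
  rewrite gmulfF /= wy ww /=; congr (_, _); last by rewrite divg1.
  by apply/ffunP=> t; rewrite !ffunE /= invg1 !conjg1 GRing.mulrnBl.
move=> _ [i [h ->]].
have [lt_i|ge_i] := ltnP i n.-1; last first.
  exists 0%R; split.
    rewrite /pure_comb big1 => [|t _]; last by rewrite ffunE mulr0z.
    by rewrite /crystal_gen insubF ?mulg1 ?conj1g // ltnNge ge_i.
  rewrite {1 2}/crystal_gen insubF ?mulg1 ?conj1g ?ltnNge ?ge_i // gmulf1.
  congr (_, _); apply/ffunP=> t; rewrite !ffunE; lia.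
(* All generators are conjugate, so only conjugates of [g 0 * g 0], the class of A_12, remain. *)
have [c ->] := crystal_gen_conj0 lt_i.
rewrite -conjMg -conjgM; move: (c * h) => {}h.
exists (delta (sigma_bar (g 0) ^ sigma_bar h)); split.
  by rewrite pure_comb_delta pure_genE.
rewrite gmulfJ gmulfM /=.
have lt0 : 0 < n.-1 by lia.
have g0E : g 0 = crystal_pi (braid_gen (Ordinal lt0)).
  by rewrite -crystal_genE.
have -> : crystal_wreath (g 0) = (delta (sigma_bar (g 0)), sigma_bar (g 0)).
  rewrite g0E crystal_wreath_pi sigma_bar_pi sigma_gen.
  exact: (pres_lift_gen (@wreath_gen_rels n)).
have s00 : sigma_bar (g 0) * sigma_bar (g 0) = 1.
  by rewrite -sigma_barM sigma_bar_square.
(* For the transposition [s] of [g 0], the square of ([delta s], [s]) is (2 [delta s], 1), because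
   [s * s = 1] and [s ^ s = s]. *)
rewrite [_ * _]wreathM /wreath_mul /= s00 wreath_conj crystal_wreath_sigma.
congr (_, _).
apply/ffunP=> t; rewrite !ffunE.
have ss : sigma_bar (g 0) ^ (sigma_bar (g 0))^-1 = sigma_bar (g 0).
  by rewrite conjgE invgK mulgV mulg1.
rewrite (can2_eq (conjgK (sigma_bar (g 0))) (conjgKV _)) ss.
by rewrite (can2_eq (conjgKV (sigma_bar h)) (conjgK _)) GRing.mulr2n.
Qed.

(** * Conjugacy of elements of finite order *)

Lemma are_conj_same_perm (k : nat) (x y : crystal_braid n) : 0 < k ->
  x ^+ k = 1 -> y ^+ k = 1 -> sigma_bar x = sigma_bar y -> are_conj x y.
Proof.
move=> k_gt0 xk yk xy.
have [v [vE wE]] : exists v : {ffun 'S_n -> int},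
    val (pure_comb v) = y * x^-1 /\
    crystal_wreath (y * x^-1) = ([ffun t => v t *+ 2]%R, 1).
  by apply: crystal_kernel_comb; rewrite gmulfF /= xy divgg.
pose s := sigma_bar x.
have sk : s ^+ k = 1 by rewrite -gmulfXn /= xk gmulf1.
have sum0 z (w : {ffun 'S_n -> int}) :
    z ^+ k = 1 -> crystal_wreath z = (w, s) ->
    forall t, (\sum_(i < k) w (t ^ (s ^+ i))%g = 0)%R.
  move=> zk zw t.
  have : crystal_wreath z ^+ k = 1 by rewrite -gmulfXn zk gmulf1.
  rewrite zw wreath_exp => /(congr1 (fun p : conj_wreath _ => p.1 t)).
  by rewrite !ffunE.
case wx: (crystal_wreath x) (crystal_wreath_sigma x) => [u s'] /= es'.
rewrite {s'}es' -/s in wx.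
have wy : crystal_wreath y = ([ffun t => v t *+ 2 + u t]%R, s).
  rewrite -[y](mulgVK x) crystal_wreathM wE wx wreathM /wreath_mul /= mul1g.
  congr (_, _).
  by apply/ffunP=> t; rewrite !ffunE conjg1.
pose p := perm (@conjg_inj _ s).
have pX i t : (p ^+ i) t = t ^ (s ^+ i).
  elim: i => [|i IHi]; first by rewrite perm1 conjg1.
  by rewrite !expgSr permM IHi permE conjgM.
have [//| |t|b bE] := @orbit_sum_coboundary _ p k v.
- by apply/permP=> t; rewrite pX sk conjg1 perm1.
(* The norm for [y] is twice the norm of [v] plus the norm for [x]. The norms for [x] and [y]
   vanish, hence so does that of [v]. *)
- have := sum0 y _ yk wy t.
  under eq_bigr => i _ do rewrite ffunE.
  rewrite big_split /= (sum0 _ _ xk wx) GRing.addr0 GRing.sumrMnl => /eqP.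
  rewrite Num.Theory.mulrn_eq0 /= => /eqP; under eq_bigr => i _ do rewrite -pX.
  by [].
(* With m this element, the coboundary equation reads y x^-1 = m^-1 x m x^-1, that is, y = m^-1 x
   m. *)
exists (val (pure_comb b)).
have e : pure_comb v = (kernel_conj x^-1 (pure_comb b) - pure_comb b)%R.
  rewrite pure_comb_conj -pure_combB; apply: eq_bigr => t _; congr (_ *~ _)%R.
  by rewrite bE permE gmulfV /= invgK.
move/(congr1 val): e; rewrite vE GRing.addrC /= => /(canRL (mulgKV _)) ->.
by rewrite !conjgE invgK -!mulgA mulVg mulg1.
Qed.

(** Adjacent transpositions yield all transpositions by induction on the distance of the two points,
    and these yield all permutations. *)
Lemma sigma_bar_onto (t : 'S_n) : exists q, sigma_bar q = t.
Proof.
have onM s u : (exists q, sigma_bar q = s) -> (exists q, sigma_bar q = u) ->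
    exists q : crystal_braid n, sigma_bar q = s * u.
  by move=> [q <-] [r <-]; exists (q * r); rewrite sigma_barM.
have on1 : exists q : crystal_braid n, sigma_bar q = 1.
  by exists 1; rewrite sigma_bar1.
have on_adj (a b : 'I_n) : b = a.+1 :> nat -> exists q, sigma_bar q = tperm a b.
  move=> ab; exists (g a); apply/permP=> c; apply: val_inj.
  have lt_bn := ltn_ord b; rewrite /= sigma_bar_gen -?ab //.
  by case: tpermP => [->|->|/eqP + /eqP]; rewrite -?val_eqE /= ?eqxx ?ab //;
    do ?case: eqP; lia.
have on_lt d (a b : 'I_n) :
    b = a + d.+1 :> nat -> exists q, sigma_bar q = tperm a b.
  elim: d b => [|d IHd] b ab; first by apply: on_adj; lia.
  have lt_bn := ltn_ord b; have lt_c : b.-1 < n by lia.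
  pose c := Ordinal lt_c.
  have [q qE] : exists q, sigma_bar q = tperm a c.
    by apply: IHd; rewrite /=; lia.
  have [r rE] : exists r, sigma_bar r = tperm c b.
    by apply: on_adj; rewrite /=; lia.
  (* The transposition (a, b) is the conjugate of (a, b-1) by (b-1, b). *)
  exists (q ^ r); rewrite gmulfJ /= qE rE tpermJ tpermL tpermD //.
    by rewrite -val_eqE /=; lia.
  by rewrite -val_eqE /=; lia.
have on_tperm (a b : 'I_n) : exists q, sigma_bar q = tperm a b.
  case: (ltngtP a b) => [ab|ba|/val_inj ->]; last by rewrite tperm1.
    by apply: (on_lt (b - a).-1); lia.
  by rewrite tpermC; apply: (on_lt (a - b).-1); lia.
have [ts -> _] := prod_tpermP t.
by elim: ts => [|u ts IHts]; rewrite ?big_nil ?big_cons //; apply: onM.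
Qed.

Lemma are_conj_perm (k : nat) (x y : crystal_braid n) (t : 'S_n) : 0 < k ->
  x ^+ k = 1 -> y ^+ k = 1 -> sigma_bar y = sigma_bar x ^ t -> are_conj x y.
Proof.
move=> k_gt0 xk yk yt; have [h hE] := sigma_bar_onto t.
have [z ->] : are_conj (x ^ h) y.
  apply: are_conj_same_perm k_gt0 _ yk _; first by rewrite -conjXg xk conj1g.
  by rewrite gmulfJ /= hE.
by exists (h * z); rewrite conjgM.
Qed.

(** * From elements to cyclic subgroups *)

Lemma finite_subset_eq (T : choiceType) (A B : set T) k :
  (A #= `I_k)%card -> (B #= `I_k)%card -> (A `<=` B)%classic -> A = B.
Proof.
move=> Ak Bk AB.
have Afin : finite_set A by apply/finite_setP; exists k.
have Bfin : finite_set B by apply/finite_setP; exists k.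
apply: (fset_set_inj Afin Bfin); apply/eqP.
rewrite eqEfcard (card_fset_set Ak) (card_fset_set Bk) leqnn andbT.
by rewrite -(fset_set_sub Afin Bfin).
Qed.

(** Otherwise the powers of [x] would be infinitely many elements of [H]. *)
Lemma finite_subgroup_expg (G : groupType) (H : set G) (x : G) :
  is_subgroup H -> finite_set H -> H x -> exists2 k, 0 < k & x ^+ k = 1.
Proof.
move=> [H1 HF] finH Hx; apply: contrapT => nk.
have HV y : H y -> H y^-1 by move=> Hy; rewrite -[_^-1]mul1g; apply: HF.
have HX i : H (x ^+ i).
  elim: i => [|i IHi] //; rewrite expgSr -[x in _ * x]invgK.
  by apply: HF => //; apply: HV.
have X_inj : injective (fun i => x ^+ i).
  move=> i j; wlog ij : i j / i <= j => [W e|/= e].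
    by have [/W|/ltnW/W] := leqP i j; [apply | move/(_ (esym e))].
  have [//|ne] := eqVneq i j; case: nk; exists (j - i); first by lia.
  by rewrite expgnFr // e mulgV.
apply: infinite_nat.
have card_X := inj_card_eq (A := setT) (in2W X_inj).
rewrite -(eq_finite_set card_X).
by apply: sub_finite_set finH => _ [i _ <-].
Qed.

(** Some [z] in [K] lies over the conjugate by [t] of the permutation of a generator [x] of [H].
    Both have finite order, so some [h] conjugates [x] to [z]. It carries [H] into [K], and equal
    cardinalities give equality. *)
Lemma are_conj_sets_perm (k : nat) (H K : set (crystal_braid n)) :
  cyclic_subgroup_of_order k H -> cyclic_subgroup_of_order k K ->
  are_conj_sets (@sigma_bar n @` H)%classic (@sigma_bar n @` K)%classic ->
  are_conj_sets H K.
Proof.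
move=> [[x Hx] Hk] [[y Ky] Kk] [t tE].
have [finH finK] : finite_set H /\ finite_set K.
  by split; apply/finite_setP; exists k.
have sH : is_subgroup H by rewrite Hx; apply: subgroup_gen_subgroup.
have sK : is_subgroup K by rewrite Ky; apply: subgroup_gen_subgroup.
have Hxx : H x by rewrite Hx; apply: sub_subgroup_gen.
have [z Kz zE] : (@sigma_bar n @` K)%classic (sigma_bar x ^ t).
  by rewrite tE; exists (sigma_bar x) => //; exists x.
have [a a_gt0 xa] := finite_subgroup_expg sH finH Hxx.
have [b b_gt0 zb] := finite_subgroup_expg sK finK Kz.
have [h zh] : are_conj x z.
  (* The product [a * b] is a common exponent for [x] and [z]. *)
  apply: (@are_conj_perm (a * b) _ _ t) => //; first by rewrite muln_gt0 a_gt0.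
    by rewrite expgnA xa expg1n.
  by rewrite mulnC expgnA zb expg1n.
exists h; apply/esym; apply: (finite_subset_eq _ Kk).
  apply: card_eq_trans Hk; apply: inj_card_eq => ? ? _ _; exact: conjg_inj.
move=> _ [u Hu <-]; move: u Hu; rewrite Hx.
apply: (@subgroup_gen_min _ _ (fun u => K (u ^ h))); last first.
  by move=> _ ->; rewrite -zh.
have [K1 KF] := sK; split=> [|u v Ku Kv]; first by rewrite /= conj1g.
by rewrite /= conjMg conjVg; apply: KF.
Qed.
End CrystalConjugacy.


Local Open Scope classical_set_scope.

Theorem theorem5 (n k : nat) (n_ge3 : (3 <= n)%N) (k_ge3 : (3 <= k)%N)
    (k_odd : odd k) :
  (forall x y : crystal_braid n, has_order k x -> has_order k y ->
     (are_conj x y <-> cycle_type (sigma_bar x) = cycle_type (sigma_bar y)))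
  /\
  (forall H K : set (crystal_braid n),
     cyclic_subgroup_of_order k H -> cyclic_subgroup_of_order k K ->
     (are_conj_sets H K <->
      are_conj_sets (@sigma_bar n @` H) (@sigma_bar n @` K))).
Proof.
split=> [x y [k_gt0 xk _] [_ yk _]|H K Hk Kk]; split.
- by move=> [h ->]; rewrite gmulfJ /=; apply/esym; apply: cycle_typeJ.
- move=> /cycle_type_conj[t]; exact: are_conj_perm k_gt0 xk yk.
- move=> [h ->]; exists (sigma_bar h); rewrite !image_comp.
  by apply: eq_imagel => x _ /=; rewrite gmulfJ.
- exact: are_conj_sets_perm Hk Kk.
Qed.
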